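(* Let $R$ be a ring with identity and let $U$ be a right $R$-module that is both hollow and uniform. Put $M = U^2 = U \times U$, $U_1 = U \times 0$ and $U_2 = 0 \times U$ (submodules of $M$). Then the following conditions are equivalent: (a) $M$ is lifting; (b) for any right $R$-module $X$, any homomorphism $f : U_1 \to X$ and any epimorphism $g : U_2 \to X$, one of the following holds: (i) there exists a homomorphism $h : U_1 \to U_2$ such that $f = gh$; (ii) there exist a submodule $N$ of $U_2$ and an epimorphism $h : N \to U_1$ such that $g|_N = fh$; (c) for any right $R$-module $X$, any homomorphism $f : U_1 \to X$ and any epimorphism $g : U_2 \to X$, one of the following holds: (i) there exists a homomorphism $h : U_1 \to U_2$ such that $f = gh$; (ii) there exist a submodule $K$ of $\operatorname{Ker} g$ and a monomorphism $h : U_1 \to U_2/K$ such that $g'h = f$, where $g' : U_2/K \to X$ is defined by $g'(\overline{u}) = g(u)$ for $\overline{u} \in U_2/K$.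
   Context: All modules are unitary right modules over a ring $R$ with identity. A submodule $N$ of a module $M$ is small in $M$ if $N + X \neq M$ for every proper submodule $X$ of $M$. A module $M$ is lifting if for any submodule $N$ of $M$ there exists a direct summand $X$ of $M$ with $X \subseteq N$ such that $N/X$ is small in $M/X$. A module $M$ is extending if for any submodule $N$ of $M$ there exists a direct summand $X$ of $M$ such that $N$ is an essential submodule of $X$. A hollow module is an indecomposable (in particular nonzero) lifting module; equivalently, a nonzero module all of whose proper submodules are small. A uniform module is an indecomposable (in particular nonzero) extending module; equivalently, a nonzero module all of whose nonzero submodules are essential. Composition is written so that $gh$ means first $h$, then $g$. *)

(* Defs.v *)
From HB Require Import structures.
From mathcomp Require Import all_boot all_algebra.
From mathcomp Require Import generic_quotient ring_quotient.
From mathcomp Require Import boolp.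

Set Implicit Arguments.
Unset Strict Implicit.
Unset Printing Implicit Defensive.

Import GRing.Theory.
Local Open Scope ring_scope.
Local Open Scope quotient_scope.

(* A right R-module is a left module over the converse ring R^c: the product *)
(* u r is written r *: u, and (r *: (s *: u)) = (s * r) *: u in R.           *)
Notation rmodType R := (lmodType R^c).

(* Submodules of M are the elements of MathComp's submodClosed M: predicates *)
(* closed under 0, + and scaling. They are boolean, but asbool turns any     *)
(* Prop-valued predicate into a boolean one. Extensional equality is =i.     *)

Section SubmoduleAsModule.
Variables (R : pzRingType) (M : lmodType R) (N : submodClosed M).

Record submod : predArgType := Submod {
  submod_val : M;
  submod_valP : submod_val \in N }.

HB.instance Definition _ := [isSub for submod_val].
HB.instance Definition _ := [Choice of submod by <:].

HB.instance Definition _ := [SubChoice_isSubLmodule of submod by <:].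

End SubmoduleAsModule.

Section Quotient.
Variables (R : pzRingType) (M : lmodType R) (N : submodClosed M).

Definition submod_zmod : {pred M} := fun x => x \in N.

Fact submod_zmod_closed : zmod_closed submod_zmod.
Proof. exact: GRing.submod_closedB (submodClosedP N). Qed.

HB.instance Definition _ :=
  GRing.isZmodClosed.Build M submod_zmod submod_zmod_closed.

Definition quotmod : Type := Quotient.quot submod_zmod.

HB.instance Definition _ := GRing.Zmodule.on quotmod.
HB.instance Definition _ := EqQuotient.on quotmod.

Definition quot_proj (x : M) : quotmod := \pi_quotmod x.

Lemma quot_projP x y : reflect (quot_proj x = quot_proj y) (x - y \in N).
Proof.
apply: (iffP idP) => [xyN|/eqP].
  by apply/eqP; rewrite -(Quotient.idealrBE submod_zmod x y).
by rewrite -(Quotient.idealrBE submod_zmod x y).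
Qed.

Definition quot_scale (a : R) (q : quotmod) : quotmod :=
  quot_proj (a *: repr q).

Lemma quot_projK (q : quotmod) : quot_proj (repr q) = q.
Proof. exact: reprK. Qed.

Lemma quot_projD x y : quot_proj (x + y) = quot_proj x + quot_proj y.
Proof. exact: (raddfD (\pi_(Quotient.quot submod_zmod))). Qed.

Lemma quot_scaleE a x : quot_scale a (quot_proj x) = quot_proj (a *: x).
Proof.
apply/quot_projP; rewrite -scalerBr rpredZ //; apply/quot_projP.
by rewrite quot_projK.
Qed.

Fact quot_scaleA a b q :
  quot_scale a (quot_scale b q) = quot_scale (a * b) q.
Proof. by rewrite -[q]quot_projK !quot_scaleE scalerA. Qed.

Fact quot_scale1 : left_id 1 quot_scale.
Proof. by move=> q; rewrite -[q]quot_projK quot_scaleE scale1r. Qed.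

Fact quot_scaleDr : right_distributive quot_scale +%R.
Proof.
move=> a p q; rewrite -[p]quot_projK -[q]quot_projK -quot_projD.
by rewrite !quot_scaleE scalerDr quot_projD.
Qed.

Fact quot_scaleDl q : {morph quot_scale^~ q : a b / a + b}.
Proof.
move=> a b; rewrite -[q]quot_projK !quot_scaleE scalerDl.
exact: quot_projD.
Qed.

HB.instance Definition _ := GRing.Zmodule_isLmodule.Build R quotmod
  quot_scaleA quot_scale1 quot_scaleDr quot_scaleDl.

Fact quot_proj_is_linear : linear quot_proj.
Proof.
by move=> a x y; rewrite quot_projD -quot_scaleE.
Qed.

HB.instance Definition _ :=
  GRing.isLinear.Build R M quotmod _ quot_proj quot_proj_is_linear.

End Quotient.

Section QuotientSubmodule.
Variables (R : pzRingType) (M : lmodType R) (X N : submodClosed M).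

(* The submodule (N + X) / X of M / X; this is N / X when X is contained in N. *)
Definition quotsub_pred : pred (quotmod X) :=
  fun q => `[< exists2 n, n \in N & q = quot_proj X n >].

Fact quotsub_closed : submod_closed quotsub_pred.
Proof.
split=> [|a p q /asboolP[x xN ->] /asboolP[y yN ->]]; apply/asboolP.
  by exists 0; rewrite ?rpred0 ?raddf0.
by exists (a *: x + y); rewrite ?rpredD ?rpredZ // linearP.
Qed.

Definition quotsub : submodClosed (quotmod X) :=
  HB.pack quotsub_pred
    (GRing.isSubmodClosed.Build R (quotmod X) quotsub_pred quotsub_closed).

End QuotientSubmodule.

Arguments quotsub {R M} X N.

Section Induced.
Variables (R : pzRingType) (M X : lmodType R) (g : {linear M -> X}).

Definition kerm_pred : pred M := fun u => g u == 0.

Fact kerm_closed : submod_closed kerm_pred.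
Proof.
split=> [|a x y /eqP x0 /eqP y0]; apply/eqP; first exact: raddf0.
by rewrite linearP x0 y0 scaler0 addr0.
Qed.

Definition kerm : submodClosed M :=
  HB.pack kerm_pred (GRing.isSubmodClosed.Build R M kerm_pred kerm_closed).

(* Meaningful only when K is contained in Ker g, see quot_liftE. *)
Definition quot_lift (K : submodClosed M) (q : quotmod K) : X := g (repr q).

Lemma quot_liftE (K : submodClosed M) : {subset K <= kerm} ->
  forall u, quot_lift (quot_proj K u) = g u.
Proof.
move=> sKg u; apply/eqP; rewrite -subr_eq0 -raddfB; apply: sKg.
by apply/quot_projP; rewrite quot_projK.
Qed.

End Induced.

Section Notions.
Variables (R : pzRingType) (M : lmodType R).
Implicit Types N X Y L : submodClosed M.

Definition full N := forall m, m \in N.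
Definition null N := forall m, m \in N -> m = 0.

Definition sum_full N X :=
  forall m, exists n, exists x, [/\ n \in N, x \in X & m = n + x].
Definition trivial_inter N X := forall m, m \in N -> m \in X -> m = 0.

Definition small N := forall X, ~ full X -> ~ sum_full N X.
Definition direct_summand X := exists Y, sum_full X Y /\ trivial_inter X Y.
Definition essential_in N X :=
  {subset N <= X} /\
  forall L, {subset L <= X} -> ~ null L -> ~ trivial_inter N L.

End Notions.

Section ModuleClasses.
Variables (R : pzRingType) (M : lmodType R).

Definition lifting := forall N : submodClosed M,
  exists X : submodClosed M,
    [/\ direct_summand X, {subset X <= N} & small (quotsub X N)].

Definition extending := forall N : submodClosed M,
  exists X : submodClosed M, direct_summand X /\ essential_in N X.

Definition indecomposable :=
  (exists m : M, m <> 0) /\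
  forall X : submodClosed M, direct_summand X -> null X \/ full X.

Definition hollow := indecomposable /\ lifting.
Definition uniform := indecomposable /\ extending.

End ModuleClasses.

Section Square.
Variables (R : pzRingType) (U : lmodType R).

Definition axis1_pred : pred (U * U) := fun m => m.2 == 0.
Definition axis2_pred : pred (U * U) := fun m => m.1 == 0.

Fact axis1_closed : submod_closed axis1_pred.
Proof.
by split=> [|a x y /eqP x0 /eqP y0]; apply/eqP; rewrite //= x0 y0 scaler0 addr0.
Qed.

Fact axis2_closed : submod_closed axis2_pred.
Proof.
by split=> [|a x y /eqP x0 /eqP y0]; apply/eqP; rewrite //= x0 y0 scaler0 addr0.
Qed.

Definition axis1 : submodClosed (U * U)%type :=
  HB.pack axis1_pred
    (GRing.isSubmodClosed.Build R (U * U)%type axis1_pred axis1_closed).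
Definition axis2 : submodClosed (U * U)%type :=
  HB.pack axis2_pred
    (GRing.isSubmodClosed.Build R (U * U)%type axis2_pred axis2_closed).

End Square.

Arguments axis1 {R} U.
Arguments axis2 {R} U.

Definition epi (A B : Type) (f : A -> B) := forall y, exists x, f x = y.

(* Main.v *)
(* By hollowness, a submodule N of M = U x U projecting onto neither factor is  *)
(* small, so by symmetry let N project onto the first one. Such an N is the     *)
(* pullback of a map f on U1 and an epimorphism g on U2, and the lift h in (b)  *)
(* amounts to an X in N, its graph, which still projects onto the first factor  *)
(* and meets U1 or U2 trivially. If X is a summand, then X + U2 = M reduces the *)
(* smallness of N / X to that of N \cap U2 in U2. If X meets U2 nontrivially    *)
(* and projects properly to the second factor, neither U1 nor U2 need be a      *)
(* complement of X, but the antidiagonal D = {(u, -u)} is: X \cap D = 0 because *)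
(* U is uniform, and X + D = M because U is hollow. Conversely, a direct        *)
(* summand that meets both U1 and U2 nontrivially is M, again by uniformity.    *)

Require Import Defs.
From mathcomp Require Import all_boot all_algebra.
From HB Require Import structures.
From mathcomp Require Import boolp.

Set Implicit Arguments.
Unset Strict Implicit.
Unset Printing Implicit Defensive.

Import GRing.Theory.
Local Open Scope ring_scope.

(** All three conditions are compared through [graph_cond], which speaks only of submodules of
    [U * U]. A map [f] and an epimorphism [g] give a submodule [N] projecting onto the first factor,
    their pullback; conversely such an [N] gives the quotient map by [N] restricted to the two axes,
    with a sign on the second. Under this dictionary a lift of [f] through [g], total or partial, is
    a graph-like submodule of [N], so (b) is [graph_cond] ([lift_cond_graph_cond],
    [graph_cond_lift_cond]). Inverting a partial epimorphism modulo its kernel turns (b) into (c)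
    ([partial_epi_quot_mono]). That [graph_cond] implies (a) rests on [graph_like_summand], for
    submodules projecting onto a factor, and on [hollow_square_small] for the others. The converse,
    [lifting_graph_cond], rests on [uniform_square_trivial_inter]: a summand meeting both axes
    leaves no room for a nonzero complement. *)

Lemma exists_submod (R : pzRingType) (M : lmodType R) (P : M -> Prop) :
    P 0 -> (forall a x y, P x -> P y -> P (a *: x + y)) ->
  exists N : submodClosed M, forall x, x \in N <-> P x.
Proof.
move=> P0 PP; pose p : pred M := fun x => `[< P x >].
have pP : submod_closed p.
  by split=> [|a x y /asboolP Px /asboolP Py]; apply/asboolP => //; exact: PP.
pose N : submodClosed M :=
  HB.pack p (GRing.isSubmodClosed.Build R M p pP).
exists N => x.
by split=> [/asboolP|Px] //; apply/asboolP.
Qed.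

Lemma submod_inN (R : pzRingType) (M : lmodType R) (N : submodClosed M) x :
  x \in N -> - x \in N.
Proof. by rewrite -scaleN1r; apply: rpredZ. Qed.

Lemma submod_inB (R : pzRingType) (M : lmodType R) (N : submodClosed M) x y :
  x \in N -> y \in N -> x - y \in N.
Proof. by move=> xN /submod_inN; apply: rpredD. Qed.

Section General.
Variable R : pzRingType.

(** Single-valuedness forces the function obtained by choice to be linear. This is how graphs are
    turned back into homomorphisms. *)
Lemma linear_choice (A B : lmodType R) (P : A -> B -> Prop) :
    (forall a, exists b, P a b) ->
    (forall a b b', P a b -> P a b' -> b = b') ->
    (forall c a b a' b', P a b -> P a' b' -> P (c *: a + a') (c *: b + b')) ->
  exists h : {linear A -> B}, forall a, P a (h a).
Proof.
move=> /choice[h hP] uniqP linP.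
have hlin : linear h by move=> c a a'; apply: uniqP (hP _) _; exact: linP.
pose lh : {linear A -> B} := HB.pack h (GRing.isLinear.Build R A B _ h hlin).
by exists lh.
Qed.

Lemma axis_decomp (U : lmodType R) (m : U * U) :
  exists u v, m = val (u : submod (axis1 U)) + val (v : submod (axis2 U)).
Proof.
have a1 : (m.1, 0 : U) \in axis1 U by apply/eqP.
have a2 : (0 : U, m.2) \in axis2 U by apply/eqP.
exists (Submod a1), (Submod a2); rewrite [LHS]surjective_pairing.
by congr (_, _); rewrite /= ?addr0 ?add0r.
Qed.

Lemma axis1_val (U : lmodType R) (u : submod (axis1 U)) :
  val u = ((val u).1, 0).
Proof. by case: u => [[a b]] /= /[dup] ab /eqP /= b0; rewrite -b0. Qed.

Lemma axis2_val (U : lmodType R) (v : submod (axis2 U)) :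
  val v = (0, (val v).2).
Proof. by case: v => [[a b]] /= /[dup] ab /eqP /= a0; rewrite -a0. Qed.

Lemma axis_sum (U : lmodType R) (u : submod (axis1 U)) (v : submod (axis2 U)) :
  val u + val v = ((val u).1, (val v).2).
Proof.
by rewrite axis1_val axis2_val; congr (_, _); rewrite /= ?addr0 ?add0r.
Qed.

Lemma axis_sum_inj (U : lmodType R) (u u' : submod (axis1 U))
    (v v' : submod (axis2 U)) :
  val u + val v = val u' + val v' -> u = u' /\ v = v'.
Proof.
rewrite !axis_sum => -[uu' vv']; split; apply: val_inj.
  by rewrite axis1_val uu' -axis1_val.
by rewrite axis2_val vv' -axis2_val.
Qed.

(** * Smallness in quotients, hollow and uniform modules *)

Section Notions.
Variable M : lmodType R.
Implicit Types N X Y Z F L : submodClosed M.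

(** Submodules of [M / X] correspond to the submodules of [M] containing [X], so smallness can be
    tested without the quotient. *)
Lemma small_quotsubP X N :
  small (quotsub X N) <->
  forall L, {subset X <= L} -> sum_full N L -> full L.
Proof.
split=> [sN L XL NL|H Q nQ NQ].
  apply: contrapT => nL; apply: (sN (quotsub X L)).
    move=> fL; apply: nL => m; have /asboolP[l lL] := fL (quot_proj X m).
    by move=> /quot_projP/XL ml; rewrite -(subrK l m) rpredD.
  move=> q; rewrite -(quot_projK q); have [n [l [nN lL ->]]] := NL (repr q).
  exists (quot_proj X n), (quot_proj X l).
  by split; [apply/asboolP; exists n|apply/asboolP; exists l|exact: quot_projD].
have [||L LP] := @exists_submod R M (fun m => quot_proj X m \in Q).
- by rewrite raddf0 rpred0.
- by move=> a x y xQ yQ; rewrite linearP rpredD ?rpredZ.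
apply: nQ => q; rewrite -(quot_projK q).
apply/LP; apply: (H L) => [x xX|m].
  apply/LP; suff -> : quot_proj X x = 0 by exact: rpred0.
  by rewrite -(raddf0 (quot_proj X)); apply/quot_projP; rewrite subr0.
have [q1 [q2 [/asboolP[n nN ->] q2Q mE]]] := NQ (quot_proj X m).
exists n, (m - n); split => //; last by rewrite addrC subrK.
by apply/LP; rewrite raddfB /= mE addrC addKr.
Qed.

(** The summand inside [N] supplied by lifting is zero or everything; in the first case [N] itself
    is small. *)
Lemma hollow_sum N L : hollow M -> sum_full N L -> full N \/ full L.
Proof.
move=> [[_ indM] /(_ N)[X [/indM[nX|fX] XN /small_quotsubP sN]]] NL.
  by right; apply: sN => // x /nX->; exact: rpred0.
by left=> m; apply: XN.
Qed.

Lemma uniform_inter N L : uniform M -> trivial_inter N L -> null N \/ null L.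
Proof.
move=> [[_ indM] /(_ N)[X [/indM[nX|fX] [NX essN]]]] NL.
  by left=> m /NX/nX.
right; apply: contrapT => nL.
by apply: (essN L).
Qed.

Lemma exists_null : exists Z : submodClosed M, null Z.
Proof.
have [//||Z ZP] := @exists_submod R M (fun m => m = 0).
  by move=> a x y -> ->; rewrite scaler0 addr0.
by exists Z => m /ZP.
Qed.

Lemma exists_full : exists F : submodClosed M, full F.
Proof.
have [//|//|F FP] := @exists_submod R M (fun=> True).
by exists F => m; apply/FP.
Qed.

Lemma full_summand F : full F -> direct_summand F.
Proof.
move=> fF; have [Z nZ] := exists_null; exists Z; split=> [m|m _ /nZ//].
by exists m, 0; rewrite rpred0 addr0.
Qed.

Lemma null_summand Z : null Z -> direct_summand Z.
Proof.
move=> nZ; have [F fF] := exists_full; exists F; split=> [m|m /nZ//].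
by exists 0, m; rewrite rpred0 add0r.
Qed.

Definition liftable N := exists X,
  [/\ direct_summand X, {subset X <= N} & small (quotsub X N)].

End Notions.

(** * From graph-like submodules to lifting *)

Definition proj1_onto (U : lmodType R) (N : submodClosed (U * U)%type) :=
  forall u, exists v, (u, v) \in N.
Definition proj2_onto (U : lmodType R) (N : submodClosed (U * U)%type) :=
  forall v, exists u, (u, v) \in N.

(* X is the graph of a map U1 -> U2 in the first alternative, and of an       *)
(* epimorphism from a submodule of U2 onto U1 in the second one.              *)
Definition graph_like (U : lmodType R) (X : submodClosed (U * U)%type) :=
  proj1_onto X /\
  ((forall v, (0, v) \in X -> v = 0) \/ (forall u, (u, 0) \in X -> u = 0)).

Definition graph_cond (U : lmodType R) :=
  forall N : submodClosed (U * U)%type, proj1_onto N ->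
  exists2 X : submodClosed (U * U)%type, {subset X <= N} & graph_like X.

Section Pairs.
Variables (U V : lmodType R) (X : submodClosed (U * V)%type).

Lemma pair_inD a b c d :
  (a, b) \in X -> (c, d) \in X -> (a + c, b + d) \in X.
Proof. exact: rpredD. Qed.

Lemma pair_inB a b c d :
  (a, b) \in X -> (c, d) \in X -> (a - c, b - d) \in X.
Proof. exact: submod_inB. Qed.

Lemma pair_inP k a b c d :
  (a, b) \in X -> (c, d) \in X -> (k *: a + c, k *: b + d) \in X.
Proof. by move=> /(rpredZ k); apply: rpredD. Qed.

End Pairs.

Lemma graph_like_summand (U : lmodType R) (X : submodClosed (U * U)%type) :
  hollow U -> uniform U -> graph_like X -> direct_summand X.
Proof.
move=> hU uU [X1 X0].
have comp2 : (forall v, (0, v) \in X -> v = 0) -> direct_summand X.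
  move=> X2; exists (axis2 U); split=> [[a b]|[a b] abX /eqP /= a0].
    have [c acX] := X1 a; exists (a, c), (0, b - c); split => //.
      by apply/eqP.
    by congr (_, _); rewrite /= ?addr0 // addrC subrK.
  by move: abX; rewrite a0 => /X2->.
case: X0 => [/comp2//|X2].
(* [S] is the intersection of [X] with the antidiagonal and [K] the one with the second axis. They
   are independent because [X] meets the first axis trivially; by uniformity one of them
   vanishes. *)
have [||S SP] := @exists_submod R U (fun u => (- u, u) \in X).
- by rewrite oppr0 rpred0.
- by move=> a x y xX yX; rewrite opprD -scalerN; apply: pair_inP.
have [||K KP] := @exists_submod R U (fun u => (0, u) \in X).
- exact: rpred0.
- by move=> a x y xX yX; rewrite -(addr0 0) -{1}(scaler0 _ a); apply: pair_inP.
have [] := @uniform_inter U S K uU; last 1 first.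
- by move=> nK; apply: comp2 => v /KP/nK.
- move=> u /SP uS /KP uK; have := pair_inB uK uS.
  by rewrite sub0r opprK subrr => /X2.
move=> nS.
(* [T] is the image of [X] under addition, whose kernel is the antidiagonal, so [T] is full when [X]
   and the antidiagonal span. [P] is the second projection of [X]. From [u = (u + v) - v], [T] and
   [P] together span [U], and hollowness makes one of them full. *)
have [||T TP] :=
  @exists_submod R U (fun t => exists u v, (u, v) \in X /\ t = u + v).
- by exists 0, 0; rewrite rpred0 addr0.
- move=> a _ _ [u [v [uvX ->]]] [u' [v' [uvX' ->]]].
  exists (a *: u + u'), (a *: v + v').
  by split; [exact: pair_inP | rewrite scalerDr addrACA].
have [||P PP] := @exists_submod R U (fun v => exists u, (u, v) \in X).
- by exists 0; rewrite rpred0.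
- by move=> a v v' [u uvX] [u' uvX']; exists (a *: u + u'); apply: pair_inP.
have [] := @hollow_sum U T P hU.
- move=> u; have [v uvX] := X1 u; exists (u + v), (- v); split.
  + by apply/TP; exists u, v.
  + by apply/submod_inN/PP; exists u.
  + by rewrite addrK.
- move=> fT; have [||D DP] :=
    @exists_submod R (U * U)%type (fun m => m.1 + m.2 = 0).
  + by rewrite /= addr0.
  + by move=> a x y x0 y0; rewrite /= addrACA -scalerDr x0 y0 scaler0 addr0.
  exists D; split=> [[a b]|[a b] abX /DP /= ab0].
    have /TP[u [v [uvX abE]]] := fT (a + b).
    exists (u, v), (a - u, b - v); split => //.
      by apply/DP; rewrite /= addrACA -opprD abE subrr.
    by congr (_, _); rewrite /= addrC subrK.
  have /eqP := ab0; rewrite addr_eq0 => /eqP aE.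
  have b0 : b = 0 by apply: nS; apply/SP; rewrite -aE.
  by rewrite aE b0 oppr0.
- move=> fP; exists (axis1 U); split=> [[a b]|[a b] abX /eqP /= b0].
    have /PP[c cbX] := fP b; exists (c, b), (a - c, 0); split => //.
      by apply/eqP.
    by congr (_, _); rewrite /= ?addr0 // addrC subrK.
  by move: abX; rewrite b0 => /X2->.
Qed.

Lemma graph_cond_liftable1 (U : lmodType R) (N : submodClosed (U * U)%type) :
  hollow U -> uniform U -> graph_cond U -> proj1_onto N -> liftable N.
Proof.
move=> hU uU gU N1.
(* Once [N] is proper, its intersection with the second axis is proper as well, hence small in
   [U]. *)
have [fN|nN] := pselect (full N).
  exists N; split=> //; first exact: full_summand.
  by apply/small_quotsubP => L NL _ m; apply/NL/fN.
have [X XN gX] := gU N N1; exists X; split => //.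
  exact: graph_like_summand.
have [X1 _] := gX; apply/small_quotsubP => L XL NL.
have K2 (Q : submodClosed (U * U)%type) : {subset X <= Q} ->
    (forall v, (0, v) \in Q) -> full Q.
  move=> XQ Q2 [a b]; have [c /XQ acQ] := X1 a.
  by have := pair_inD acQ (Q2 (b - c)); rewrite addr0 addrC subrK.
have sec (Q : submodClosed (U * U)%type) :
    exists Q2 : submodClosed U, forall v, v \in Q2 <-> (0, v) \in Q.
  apply: exists_submod; first exact: rpred0.
  by move=> a x y xX yX; rewrite -(addr0 0) -{1}(scaler0 _ a); apply: pair_inP.
have [N2 N2P] := sec N; have [L2 L2P] := sec L.
have [] := @hollow_sum U N2 L2 hU.
(* Moving the element [(a, e)] of [X] from one summand to the other brings both into the second axis
   and keeps their sum. *)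
- move=> v; have [[a b] [[c d] [abN cdL [acE bdE]]]] := NL (0, v).
  have [e aeX] := X1 a; exists (b - e), (d + e); split.
  + by apply/N2P; rewrite -(subrr a); apply/pair_inB/XN.
  + by apply/L2P; rewrite acE [a + c]addrC; apply/pair_inD/XL.
  + by rewrite bdE addrACA [- e + e]addrC subrr addr0.
- by move=> fN2; case: nN; apply: K2 => // v; apply/N2P.
- by move=> fL2; apply: K2 => // v; apply/L2P.
Qed.

Lemma swap_submod (U : lmodType R) (N : submodClosed (U * U)%type) :
  exists N' : submodClosed (U * U)%type,
    forall a b, (a, b) \in N' <-> (b, a) \in N.
Proof.
have [||N' N'P] := @exists_submod R (U * U)%type (fun m => (m.2, m.1) \in N).
- exact: rpred0.
- by move=> k x y; apply: pair_inP.
- by exists N' => a b; apply: iff_trans (N'P _) _.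
Qed.

Lemma liftable_swap (U : lmodType R) (N N' : submodClosed (U * U)%type) :
  (forall a b, (a, b) \in N' <-> (b, a) \in N) -> liftable N' -> liftable N.
Proof.
move=> N'P [X' [[Y' [XY' tXY']] XN' /small_quotsubP sN']].
have [X XP] := swap_submod X'; have [Y YP] := swap_submod Y'; exists X; split.
- exists Y; split=> [[a b]|[a b] /XP abX /YP /(tXY' _ abX) [-> ->] //].
  have [[c d] [[e f] [cdX efY [bE aE]]]] := XY' (b, a).
  exists (d, c), (f, e); split; first exact/XP.
    exact/YP.
  by rewrite aE bE.
- by move=> [a b] /XP/XN'/N'P.
apply/small_quotsubP => L XL NL; have [L' L'P] := swap_submod L.
move=> [a b]; apply/L'P; apply: sN' => [[c d] cdX|[c d]].
  by apply/L'P/XL/XP.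
have [[e f] [[g h] [efN ghL [dE cE]]]] := NL (d, c).
exists (f, e), (h, g); split; first exact/N'P.
  exact/L'P.
by rewrite cE dE.
Qed.

(** A proper submodule of a hollow module is small, and homomorphic images of small submodules are
    small. *)
Lemma hollow_image_sum (U M : lmodType R) (i : {linear U -> M})
    (A : submodClosed U) (L : submodClosed M) : hollow U -> ~ full A ->
    (forall m, exists a l, [/\ a \in A, l \in L & m = i a + l]) -> full L.
Proof.
move=> hU nA AL.
have [||L' L'P] := @exists_submod R U (fun u => i u \in L).
- by rewrite raddf0 rpred0.
- by move=> k x y xL yL; rewrite linearP rpredD ?rpredZ.
have [u|//|fL' m] := @hollow_sum U A L' hU.
  have [a [l [aA lL uE]]] := AL (i u); exists a, (u - a); split => //.
    by apply/L'P; rewrite raddfB /= uE addrC addKr.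
  by rewrite addrC subrK.
have [a [l [_ lL ->]]] := AL m; apply: rpredD => //.
exact/L'P.
Qed.

(** [N] lies in the product of its projections [A] and [B], both proper in [U]. Their images on the
    axes are small, so they can be cancelled one after the other. *)
Lemma hollow_square_small (U : lmodType R) (N L : submodClosed (U * U)%type) :
  hollow U -> ~ proj1_onto N -> ~ proj2_onto N -> sum_full N L -> full L.
Proof.
move=> hU nN1 nN2 NL.
have [||A AP] := @exists_submod R U (fun a => exists b, (a, b) \in N).
- by exists 0; rewrite rpred0.
- by move=> k a a' [b abN] [b' abN']; exists (k *: b + b'); apply: pair_inP.
have [||B BP] := @exists_submod R U (fun b => exists a, (a, b) \in N).
- by exists 0; rewrite rpred0.
- by move=> k b b' [a abN] [a' abN']; exists (k *: a + a'); apply: pair_inP.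
have nA : ~ full A by move=> fA; apply: nN1 => u; apply/AP.
have nB : ~ full B by move=> fB; apply: nN2 => u; apply/BP.
have in1_linear : linear (fun u : U => (u, 0 : U)).
  by move=> k x y; congr (_, _); rewrite /= scaler0 addr0.
have in2_linear : linear (fun u : U => (0 : U, u)).
  by move=> k x y; congr (_, _); rewrite /= scaler0 addr0.
pose in1 : {linear U -> (U * U)%type} :=
  HB.pack (fun u : U => (u, 0 : U)) (GRing.isLinear.Build R _ _ _ _ in1_linear).
pose in2 : {linear U -> (U * U)%type} :=
  HB.pack (fun u : U => (0 : U, u)) (GRing.isLinear.Build R _ _ _ _ in2_linear).
have [||L1 L1P] := @exists_submod R (U * U)%type
    (fun m => exists b l, [/\ b \in B, l \in L & m = in2 b + l]).
- by exists 0, 0; rewrite !rpred0 raddf0 addr0.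
- move=> k _ _ [b [l [bB lL ->]]] [b' [l' [bB' lL' ->]]].
  exists (k *: b + b'), (k *: l + l').
  by rewrite !rpredD ?rpredZ // linearP scalerDr addrACA.
apply: (hollow_image_sum (i := in2) hU nB) => m; apply/L1P; move: m.
apply: (hollow_image_sum (i := in1) hU nA) => m.
have [[a b] [l [abN lL ->]]] := NL m; exists a, (in2 b + l); split.
- by apply/AP; exists b.
- by apply/L1P; exists b, l; split=> //; apply/BP; exists a.
- by rewrite addrA; congr (_ + _); congr (_, _); rewrite /= ?addr0 ?add0r.
Qed.

Lemma graph_cond_lifting (U : lmodType R) :
  hollow U -> uniform U -> graph_cond U -> lifting (U * U)%type.
Proof.
move=> hU uU gU N.
have [N1|nN1] := pselect (proj1_onto N); first exact: graph_cond_liftable1.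
have [N2|nN2] := pselect (proj2_onto N).
  have [N' N'P] := swap_submod N; apply: (liftable_swap N'P).
  apply: graph_cond_liftable1 => // u; have [v vuN] := N2 u.
  by exists v; apply/N'P.
have [Z nZ] := @exists_null (U * U)%type; exists Z; split.
- exact: null_summand.
- by move=> m /nZ->; apply: rpred0.
- by apply/small_quotsubP => L _; apply: hollow_square_small.
Qed.

(** * From lifting to graph-like submodules *)

(** The intersections [A1] and [A2] of [X] with the axes are nonzero, hence essential in [U], and
    their product is essential in [U * U]. *)
Lemma uniform_square_trivial_inter (U : lmodType R)
    (X Y : submodClosed (U * U)%type) (u v : U) :
    uniform U -> (u, 0) \in X -> u <> 0 -> (0, v) \in X -> v <> 0 ->
  trivial_inter X Y -> null Y.
Proof.
move=> uU uX u0 vX v0 XY.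
have [||A1 A1P] := @exists_submod R U (fun a => (a, 0) \in X).
- exact: rpred0.
- by move=> k x y xX yX; rewrite -(addr0 0) -{1}(scaler0 _ k); apply: pair_inP.
have [||A2 A2P] := @exists_submod R U (fun a => (0, a) \in X).
- exact: rpred0.
- by move=> k x y xX yX; rewrite -(addr0 0) -{1}(scaler0 _ k); apply: pair_inP.
have nA1 : ~ null A1 by move=> nA1; apply: u0; apply/nA1/A1P.
have nA2 : ~ null A2 by move=> nA2; apply: v0; apply/nA2/A2P.
(* [S] collects the second coordinates of the elements of [Y] whose first coordinate lies in [A1].
   It avoids [A2], so it vanishes; then the first projection [T] of [Y] avoids [A1]. *)
have [||S SP] :=
    @exists_submod R U (fun b => exists2 a, (a, 0) \in X & (a, b) \in Y).
- by exists 0; rewrite rpred0.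
- move=> k b b' [a aX abY] [a' aX' abY']; exists (k *: a + a').
    by rewrite -(addr0 0) -{1}(scaler0 _ k); apply: pair_inP.
  exact: pair_inP.
have [b /SP[a aX abY] /A2P bX|nS|//] := uniform_inter (N := S) (L := A2) uU.
  have abX := pair_inD aX bX; rewrite addr0 add0r in abX.
  by have [] := XY _ abX abY.
have [||T TP] := @exists_submod R U (fun a => exists b, (a, b) \in Y).
- by exists 0; rewrite rpred0.
- by move=> k a a' [b abY] [b' abY']; exists (k *: b + b'); apply: pair_inP.
have [a /TP[b abY] /A1P aX|nT|//] := uniform_inter (N := T) (L := A1) uU.
  have b0 : b = 0 by apply/nS/SP; exists a.
  by move: abY; rewrite b0 => /(XY _ aX)[].
move=> [a b] abY; have a0 : a = 0 by apply/nT/TP; exists b.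
suff -> : b = 0 by rewrite a0.
by apply/nS/SP; exists a => //; rewrite a0 rpred0.
Qed.

Lemma lifting_graph_cond (U : lmodType R) :
  uniform U -> lifting (U * U)%type -> graph_cond U.
Proof.
move=> uU lU N N1; have [X [[Y [XY tXY]] XN /small_quotsubP sN]] := lU N.
have X1 : proj1_onto X.
  (* [L] is [X] plus the second axis. Together with [N] it spans, so smallness makes it full. *)
  have [||L LP] := @exists_submod R (U * U)%type
      (fun m => exists b, (m.1, b) \in X).
  - by exists 0; rewrite rpred0.
  - move=> k [a ?] [a' ?] [b abX] [b' abX'].
    by exists (k *: b + b'); apply: pair_inP.
  move=> u; suff /LP : (u, 0) \in L by [].
  apply: sN => [[a b] abX|[a b]]; first by apply/LP; exists b.
  have [c acN] := N1 a; exists (a, c), (0, b - c); split=> //.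
    by apply/LP; exists 0; rewrite rpred0.
  by congr (_, _); rewrite /= ?addr0 // addrC subrK.
have [X0|nX0] := pselect ((forall v, (0, v) \in X -> v = 0) \/
                          (forall u, (u, 0) \in X -> u = 0)).
  by exists X.
have fX : full X.
  suff nY : null Y.
    by move=> m; have [x [y [xX /nY-> ->]]] := XY m; rewrite addr0.
  move: nX0 => /not_orP[/existsNP[v /not_implyP[vX v0]]].
  move=> /existsNP[u /not_implyP[uX u0]].
  exact: uniform_square_trivial_inter uX u0 vX v0 tXY.
(* Here [N] is everything, and the graph of the zero map will do. *)
exists (axis1 U) => [m _|]; first exact/XN/fX.
split=> [u|]; first by exists 0; apply/eqP.
by left=> v /eqP.
Qed.

(** * Conditions (b) and (c) in terms of graphs *)

(** An epimorphism from [N] onto [A] with kernel [K] identifies [A] with [N / K], a submodule of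
    [B / K]. Conversely, a monomorphism into [B / K] is inverted on the preimage [N] of its
    image. *)
Lemma partial_epi_quot_mono (A B X : lmodType R)
    (f : {linear A -> X}) (g : {linear B -> X}) :
  (exists (N : submodClosed B) (h : {linear submod N -> A}),
      epi h /\ forall n : submod N, g (val n) = f (h n)) <->
  (exists (K : submodClosed B) (h : {linear A -> quotmod K}),
      [/\ {subset K <= kerm g}, injective h & quot_lift g (K := K) \o h =1 f]).
Proof.
split=> [[N [h [hepi gfh]]]|[K [h [Kg hinj gh]]]].
  have [||K KP] := @exists_submod R B (fun b => exists2 n, h n = 0 & b = val n).
  - by exists 0; rewrite raddf0.
  - move=> k _ _ [n n0 ->] [n' n0' ->]; exists (k *: n + n') => //.
    by rewrite linearP n0 n0' scaler0 addr0.
  have Kg : {subset K <= kerm g}.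
    by move=> b /KP[n n0 ->]; apply/eqP; rewrite gfh n0 raddf0.
  have [|a b b' [n na ->] [n' na' ->]|k a b a' b' [n na ->] [n' na' ->]|h' h'P]
    := @linear_choice A (quotmod K)
         (fun a q => exists2 n, h n = a & q = quot_proj K (val n)).
  - by move=> a; have [n na] := hepi a; exists (quot_proj K (val n)), n.
  - apply/quot_projP/KP; exists (n - n'); last by rewrite raddfB.
    by rewrite raddfB /= na na' subrr.
  - exists (k *: n + n'); first by rewrite linearP na na'.
    by rewrite !linearP.
  exists K, h'; split=> // [a a' aa'|a].
    have [n na nE] := h'P a; have [n' na' nE'] := h'P a'.
    have /quot_projP/KP[m m0 mE] :
      quot_proj K (val n) = quot_proj K (val n') by rewrite -nE -nE'.
    apply/eqP; rewrite -subr_eq0 -na -na' -raddfB; apply/eqP.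
    by rewrite -m0; congr (h _); apply: val_inj; rewrite -mE raddfB.
  by have [n na nE] := h'P a; rewrite /= nE quot_liftE // gfh na.
have [||N NP] := @exists_submod R B (fun b => exists a, h a = quot_proj K b).
- by exists 0; rewrite !raddf0.
- move=> k b b' [a aE] [a' aE']; exists (k *: a + a').
  by rewrite !linearP aE aE'.
have [n|n a a' <- /hinj //|k n a n' a' na na'|h' h'P] :=
  @linear_choice (submod N) A (fun n a => h a = quot_proj K (val n)).
- exact/NP/valP.
- by rewrite !linearP na na'.
exists N, h'; split=> [a|n].
  have aN : repr (h a) \in N by apply/NP; exists a; rewrite quot_projK.
  by exists (Submod aN); apply: hinj; rewrite h'P quot_projK.
by rewrite -gh /= h'P quot_liftE.
Qed.

(** Condition (b) over an arbitrary ring; the theorem takes it over [R^c]. *)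
Definition lift_cond (U : lmodType R) :=
  forall (X : lmodType R) (f : {linear submod (axis1 U) -> X})
    (g : {linear submod (axis2 U) -> X}), epi g ->
  (exists h : {linear submod (axis1 U) -> submod (axis2 U)}, f =1 g \o h) \/
  (exists (N : submodClosed (submod (axis2 U)))
      (h : {linear submod N -> submod (axis1 U)}),
      epi h /\ forall n : submod N, g (val n) = f (h n)).

Lemma lift_cond_graph_cond (U : lmodType R) : lift_cond U -> graph_cond U.
Proof.
move=> bU N N1; pose p := quot_proj N.
(* The sign in [g] makes [f u = g v] say that [val u + val v] lies in [N]. *)
pose f : {linear submod (axis1 U) -> quotmod N} := p \o val.
pose g : {linear submod (axis2 U) -> quotmod N} := p \o (-%R \o val).
have fgP u v : f u = g v -> val u + val v \in N.
  move=> /eqP; rewrite -subr_eq0 /f /g /= raddfN opprK -raddfD => /eqP uv0.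
  by rewrite -[_ + _]subr0; apply/quot_projP; rewrite uv0 raddf0.
have axis1_ex (u : U) : exists x : submod (axis1 U), val x = (u, 0).
  have u1 : (u, 0) \in axis1 U by apply/eqP.
  by exists (Submod u1).
have axis2_ex (u : U) : exists x : submod (axis2 U), val x = (0, u).
  have u1 : (0, u) \in axis2 U by apply/eqP.
  by exists (Submod u1).
have gepi : epi g.
  move=> q; case E: (repr q) => [a b]; have [c acN] := N1 a.
  (* Modulo [N], which contains [(a, c)], the pair [(a, b)] equals [(0, b - c)]; the sign in [g]
     reverses the difference. *)
  have [x xE] := axis2_ex (c - b); exists x.
  rewrite -(quot_projK q) E /g /= /p xE; apply/quot_projP.
  suff -> : - (0, c - b) - (a, b) = - (a, c) :> U * U by apply: submod_inN.
  by congr (_, _); rewrite /= ?oppr0 ?add0r // opprB addrAC subrr add0r.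
have [[h fgh]|[N' [h [hepi gfh]]]] := bU _ f g gepi.
  have [||X XP] := @exists_submod R (U * U)%type
    (fun m => exists u, m = val u + val (h u)).
  - by exists 0; rewrite !raddf0 addr0.
  - move=> k _ _ [u ->] [u' ->]; exists (k *: u + u').
    by rewrite !linearP scalerDr addrACA.
  exists X; first by move=> _ /XP[u ->]; apply: fgP; rewrite fgh.
  split=> [a|].
    have [x xE] := axis1_ex a; exists (val (h x)).2; apply/XP; exists x.
    by rewrite axis_sum xE.
  left=> v /XP[u]; rewrite axis_sum => -[u0 ->].
  suff -> : u = 0 by rewrite !raddf0.
  by apply: val_inj; rewrite axis1_val -u0.
have [||X XP] := @exists_submod R (U * U)%type
  (fun m => exists n, m = val (h n) + val (val n)).
- by exists 0; rewrite !raddf0 addr0.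
- move=> k _ _ [u ->] [u' ->]; exists (k *: u + u').
  by rewrite !linearP scalerDr addrACA.
exists X; first by move=> _ /XP[u ->]; apply: fgP; rewrite gfh.
split=> [a|].
  have [x xE] := axis1_ex a; have [n nE] := hepi x.
  by exists (val (val n)).2; apply/XP; exists n; rewrite axis_sum nE xE.
right=> v /XP[n]; rewrite axis_sum => -[-> n0].
suff -> : n = 0 by rewrite !raddf0.
by do 2!apply: val_inj; rewrite axis2_val -n0.
Qed.

Lemma graph_cond_lift_cond (U : lmodType R) : graph_cond U -> lift_cond U.
Proof.
move=> gU X f g gepi.
have [||N NP] := @exists_submod R (U * U)%type
    (fun m => exists u v, m = val u + val v /\ f u = g v).
- by exists 0, 0; rewrite !raddf0 addr0.
- move=> k _ _ [u [v [-> fg]]] [u' [v' [-> fg']]].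
  exists (k *: u + u'), (k *: v + v').
  by rewrite !linearP scalerDr addrACA fg fg'.
have [|Y YN [Y1 Y0]] := gU N.
  move=> a; have [u [w aE]] := axis_decomp (a, 0).
  have [v gv] := gepi (f u); exists (val v).2; apply/NP; exists u, v.
  rewrite axis_sum; split=> //; congr (_, _).
  by move: aE; rewrite axis_sum => -[].
have Yfg (u : submod (axis1 U)) (v : submod (axis2 U)) :
    val u + val v \in Y -> f u = g v.
  by move=> /YN/NP[u' [v' [/axis_sum_inj[-> ->]]]].
have Y1' (u : submod (axis1 U)) :
    exists v : submod (axis2 U), val u + val v \in Y.
  have [b uY] := Y1 (val u).1; have [u' [v uvE]] := axis_decomp ((val u).1, b).
  exists v; move: uvE; rewrite !axis_sum => -[uE bE].
  by rewrite -bE.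
have YP k (u u' : submod (axis1 U)) (v v' : submod (axis2 U)) :
    val u + val v \in Y -> val u' + val v' \in Y ->
    val (k *: u + u') + val (k *: v + v') \in Y.
  move=> uvY uvY'; rewrite !linearP addrACA -scalerDr rpredD //.
  exact: rpredZ.
have YB (u u' : submod (axis1 U)) (v v' : submod (axis2 U)) :
    val u + val v \in Y -> val u' + val v' \in Y ->
    val (u - u') + val (v - v') \in Y.
  by move=> uvY uvY'; rewrite !raddfB addrACA -opprD submod_inB.
(* If [Y] meets the second axis trivially, it is the graph of a total map; if it meets the first one
   trivially, it is read backwards, as a map from its second projection onto the first axis. *)
case: Y0 => Y0.
  have [//|u v v' uvY uvY'|k u v u' v'|h hP] :=
    @linear_choice (submod (axis1 U)) (submod (axis2 U))
      (fun u v => val u + val v \in Y).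
  - have := YB _ _ _ _ uvY uvY'; rewrite subrr axis_sum => /Y0 v0.
    by apply/eqP; rewrite -subr_eq0; apply/eqP/val_inj; rewrite axis2_val v0.
  - exact: YP.
  by left; exists h => u; apply/Yfg/hP.
right.
have [||N' N'P] :=
  @exists_submod R (submod (axis2 U))
    (fun v => exists u : submod (axis1 U), val u + val v \in Y).
- by exists 0; rewrite !raddf0 addr0 rpred0.
- by move=> k v v' [u uvY] [u' uvY']; exists (k *: u + u'); apply: YP.
have [n|n u u' uvY uvY'|k n u n' u'|h hP] := @linear_choice (submod N')
  (submod (axis1 U)) (fun n u => val u + val (val n) \in Y).
- exact/N'P/valP.
- have := YB _ _ _ _ uvY uvY'; rewrite subrr axis_sum => /Y0 u0.
  by apply/eqP; rewrite -subr_eq0; apply/eqP/val_inj; rewrite axis1_val u0.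
- exact: YP.
exists N', h; split=> [u|n]; last by apply/esym/Yfg/hP.
have [v uvY] := Y1' u; have vN : v \in N' by apply/N'P; exists u.
exists (Submod vN); have := YB _ _ _ _ (hP (Submod vN)) uvY.
rewrite subrr axis_sum => /Y0 u0.
by apply/eqP; rewrite -subr_eq0; apply/eqP/val_inj; rewrite axis1_val u0.
Qed.

End General.

Theorem theorem2p3 (R : pzRingType) (U : rmodType R)
    (hU : hollow U) (uU : uniform U) :
  let M : rmodType R := (U * U)%type in
  let U1 : rmodType R := submod (axis1 U) in
  let U2 : rmodType R := submod (axis2 U) in
  let condA := lifting M in
  let condB := forall (X : rmodType R)
      (f : {linear U1 -> X}) (g : {linear U2 -> X}), epi g ->
    (exists h : {linear U1 -> U2}, f =1 g \o h) \/
    (exists (N : submodClosed U2) (h : {linear submod N -> U1}),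
        epi h /\ forall n : submod N, g (val n) = f (h n)) in
  let condC := forall (X : rmodType R)
      (f : {linear U1 -> X}) (g : {linear U2 -> X}), epi g ->
    (exists h : {linear U1 -> U2}, f =1 g \o h) \/
    (exists (K : submodClosed U2) (h : {linear U1 -> quotmod K}),
        [/\ {subset K <= kerm g}, injective h & quot_lift g (K := K) \o h =1 f])
  in
  (condA <-> condB) /\ (condB <-> condC).
Proof.
move=> M U1 U2 condA condB condC; split; split.
- by move=> /(lifting_graph_cond uU)/graph_cond_lift_cond.
- by move=> /lift_cond_graph_cond; apply: graph_cond_lifting.
- move=> bU X f g gepi; have [?|?] := bU X f g gepi; [left|right] => //.
  exact/partial_epi_quot_mono.
- move=> cU X f g gepi; have [?|?] := cU X f g gepi; [left|right] => //.
  exact/partial_epi_quot_mono.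
Qed.
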